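(* Let $k \in \mathbb{N}_0$, $h \ge k+1$, let $T$ be an extremal tree of Horton–Strahler number $k+1$ and height $h$ with inner nodes labelled injectively by variables, let $F := D(F_1(T))$ and $m := 1+h-k$. Then $$\nu(\mathcal{T}_k(F)) \ge \binom{m}{\lfloor m/2\rfloor} > \frac{1}{\sqrt{2}}\frac{2^m}{\sqrt{m}} = \Theta\!\left(\frac{2^h}{\sqrt{h}}\right),$$ where the second inequality assumes $h \ge k+5$ and the $\Theta$-estimate is for fixed $k$.
   Context: Clauses are finite sets of literals without complementary pair, clause-sets finite sets of clauses. For a clause $C$, $\varphi_C$ is the partial assignment setting all literals of $C$ to $0$, $\overline{C}$ the set of complements. The prime implicates $\mathrm{prc}_0(F)$ of a clause-set $F$ are the inclusion-minimal clauses $C$ with $F \models C$. Tree clause-sets: for a full binary tree $T$ with inner nodes labelled injectively by variables, the edge from an inner node labelled $v$ to its left child is labelled $v$, to its right child $\overline{v}$; for a leaf $w$, $C_w$ is the set of edge labels on the root-to-$w$ path; $F_1(T) := \{C_w : w \text{ leaf}\}$. Doping: each clause $C \in G$ receives a distinct new variable $u_C \notin \mathrm{var}(G)$ and $D(G) := \{C\cup\{u_C\} : C \in G\}$. Horton–Strahler number: $0$ for a one-node tree; for a tree with subtrees $T_1,T_2$ it is $1+\mathrm{hts}(T_1)$ if $\mathrm{hts}(T_1)=\mathrm{hts}(T_2)$, else the maximum. An extremal tree of Horton–Strahler number $k$ and height $h$ (for $h\ge k$, $k=0\Rightarrow h=0$) is a full binary tree $T$ with $\mathrm{hts}(T)=k$,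 height $h$, and at least as many nodes as any full binary tree with Horton–Strahler number $\le k$ and height $\le h$. Trigger hypergraph $\mathcal{T}_k(F)$: vertex set $\mathrm{prc}_0(F)$, hyperedges $E^k_C := \{C' \in \mathrm{prc}_0(F) : C' \cap \overline{C} = \emptyset \text{ and } |C'\setminus C| \le k\}$ for all $C \in \mathrm{prc}_0(F)$. $\nu(G)$ is the matching number (maximum number of pairwise disjoint hyperedges) of a hypergraph $G$. *)

(* Defs.v *)
From mathcomp Require Import all_boot finmap.
From mathcomp Require Import boolp.

Set Implicit Arguments.
Unset Strict Implicit.
Unset Printing Implicit Defensive.

Local Open Scope fset_scope.

(* (v, true) is the positive literal v, (v, false) its complement. *)
Notation literal V := (V * bool)%type.

Section Clauses.
Variable V : choiceType.

Definition compl (l : literal V) : literal V := (l.1, ~~ l.2).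

Implicit Types (C : {fset literal V}) (F G : {fset {fset literal V}}).

Definition is_clause C : Prop := forall l, l \in C -> compl l \notin C.

Definition var_clause C : {fset V} := [fset l.1 | l in C].
Definition var F : {fset V} := \bigcup_(C <- F) var_clause C.

Definition satisfies (f : V -> bool) C : Prop :=
  exists2 l, l \in C & f l.1 = l.2.

Definition entails F C : Prop :=
  forall f : V -> bool, (forall D, D \in F -> satisfies f D) -> satisfies f C.

Definition prime_implicate F C : Prop :=
  [/\ is_clause C, entails F C &
      forall C', is_clause C' -> entails F C' -> C' `<=` C -> C' = C].

(* The restriction to literals over [var F] only serves to obtain a finite
   set; by [prc0P] below it excludes no prime implicate. *)
Definition prc0 F : {fset {fset literal V}} :=
  [fset C in fpowerset (var F `*` [fset true; false]) |
    `[< prime_implicate F C >]].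

Lemma var_prime_implicate F C l : prime_implicate F C -> l \in C -> l.1 \in var F.
Proof.
move=> [clC entC minC] lC; apply: contrapT => /negP lF.
have clC' : is_clause (C `\ l).
  move=> x; rewrite !in_fsetD1 => /andP[_ xC]; rewrite negb_and.
  by rewrite (clC _ xC) orbT.
have : C `\ l = C.
  apply: minC => //; last exact: fsubD1set.
  move=> f fF; pose g v := if v == l.1 then ~~ l.2 else f v.
  have gF D : D \in F -> satisfies g D.
    move=> DF; have [x xD fx] := fF _ DF; exists x => //.
    rewrite /g ifN //; apply: contra lF => /eqP <-.
    apply/bigfcupP; exists D; first by rewrite DF.
    by apply/imfsetP; exists x.
  have [x xC gx] := entC _ gF; move: gx; rewrite /g.
  case: eqP => [xl gx | xl fx].
    have xE : x = compl l.
      by rewrite /compl gx -xl; case: (x).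
    by move: (clC _ lC); rewrite -xE xC.
  exists x => //; rewrite in_fsetD1 xC andbT.
  by apply/eqP => xE; apply: xl; rewrite xE.
by move=> E; move: lC; rewrite -E in_fsetD1 eqxx.
Qed.

Lemma prc0P F C : C \in prc0 F <-> prime_implicate F C.
Proof.
split=> [|pC]; first by rewrite !inE => /andP[_ /asboolP].
rewrite !inE /= fpowersetE; apply/andP; split; last exact/asboolP.
apply/fsubsetP => l lC; rewrite in_fsetM (var_prime_implicate pC lC) /=.
by rewrite !inE; case: l.2.
Qed.

(* u assigns the new variable u_C to each clause C of G. *)
Definition doping_vars G (u : {fset literal V} -> V) : Prop :=
  {in G &, injective u} /\ {in G, forall C, u C \notin var G}.

Definition doping (u : {fset literal V} -> V) G : {fset {fset literal V}} :=
  [fset C `|` [fset (u C, true)] | C in G].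

End Clauses.

(* Full binary trees, with inner nodes labelled by elements of A. *)
Inductive tree (A : Type) : Type :=
| Leaf
| Node of A & tree A & tree A.
Arguments Leaf {A}.

Section Trees.
Variable A : Type.

Fixpoint nnodes (T : tree A) : nat :=
  if T is Node _ T1 T2 then (nnodes T1 + nnodes T2).+1 else 1.

Fixpoint height (T : tree A) : nat :=
  if T is Node _ T1 T2 then (maxn (height T1) (height T2)).+1 else 0.

Fixpoint hts (T : tree A) : nat :=
  if T is Node _ T1 T2 then
    if hts T1 == hts T2 then (hts T1).+1 else maxn (hts T1) (hts T2)
  else 0.

Fixpoint labels (T : tree A) : seq A :=
  if T is Node a T1 T2 then a :: labels T1 ++ labels T2 else [::].

End Trees.

(* The competitors T' are unlabelled trees, i.e. labelled in [unit]. *)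
Definition extremal (A : Type) (k h : nat) (T : tree A) : Prop :=
  [/\ hts T = k, height T = h &
      forall T' : tree unit, hts T' <= k -> height T' <= h ->
        nnodes T' <= nnodes T].

(* Prepending the two edge labels at the root to the clauses of the leaves of
   the two subtrees yields the sets of edge labels on root-to-leaf paths. *)
Fixpoint F1 (V : choiceType) (T : tree V) : {fset {fset literal V}} :=
  if T is Node v T1 T2 then
    [fset (v, true) |` C | C in F1 T1] `|` [fset (v, false) |` C | C in F1 T2]
  else [fset fset0].

Record hypergraph (X : choiceType) := Hypergraph {
  vertices : {fset X};
  hyperedges : {fset {fset X}};
  hyperedgesP : {in hyperedges, forall E, E `<=` vertices}
}.

Definition matching_number (X : choiceType) (H : hypergraph X) : nat :=
  \max_(M <- fpowerset (hyperedges H) | trivIfset M) #|` M|.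

Section Trigger.
Variables (V : choiceType) (k : nat) (F : {fset {fset literal V}}).

Definition trigger_edge (C : {fset literal V}) : {fset {fset literal V}} :=
  [fset C' in prc0 F |
    (C' `&` [fset compl l | l in C] == fset0) && (#|` C' `\` C| <= k)].

Definition trigger_edges := [fset trigger_edge C | C in prc0 F].

Lemma trigger_edgesP : {in trigger_edges, forall E, E `<=` prc0 F}.
Proof. by move=> _ /imfsetP[C _ ->]; apply: fset_sub. Qed.

Definition trigger_hypergraph : hypergraph {fset literal V} :=
  Hypergraph trigger_edgesP.

End Trigger.

(* Main.v *)
(* Write F for the doped clause-set.  Its prime implicates are the clauses C_S,
   S a nonempty set of leaves of T, made of the doping variables of the leaves
   in S and of the literals pure in their clauses; pure inner literals come from
   the nodes at which S meets exactly one of the two subtrees.  So C_S' lies in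
   the hyperedge of C_S only if the number of leaves of S' outside S plus the
   number of nodes at which S' is one-sided but S is not is at most k.

   Call a family (S_i) j-separated if no hyperedges of level j intersect and no
   S_i lies in the hyperedge of level j+1 of another S_i'.  Antichains are
   0-separated, and placing j-separated families with the same index set in both
   subtrees of a node yields a (j+1)-separated family.  In T every node at depth
   k has at least m leaves below it; so marking below each of these nodes the
   leaves with index in A, for A an (m/2)-subset of {0,...,m-1}, gives a
   k-separated family. *)
Require Import Defs.
From mathcomp Require Import all_boot all_order all_algebra finmap.
From mathcomp Require Import all_classical all_reals all_analysis.
From mathcomp Require Import zify.
Import Order.TTheory GRing.Theory Num.Theory.
Import numFieldNormedType.Exports.
Set Implicit Arguments.
Unset Strict Implicit.
Local Open Scope classical_set_scope.
Local Open Scope ring_scope.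

(** * Sets of leaves and the cost of one relative to another *)

Section Cost.
Local Open Scope nat_scope.
Variable V : Type.
Implicit Type T : tree V.

(** Subsets of the leaves as nested pairs of booleans, so that restricting to a subtree is a
    projection. *)
Fixpoint leafset T : Type :=
  if T is Node _ T1 T2 then (leafset T1 * leafset T2)%type else bool.

Fixpoint nleaves T : nat :=
  if T is Node _ T1 T2 then nleaves T1 + nleaves T2 else 1.

Fixpoint nonempty T : leafset T -> bool :=
  match T with
  | Leaf => fun S => S
  | Node _ T1 T2 => fun S => nonempty S.1 || nonempty S.2
  end.

Fixpoint subleaf T : leafset T -> leafset T -> bool :=
  match T with
  | Leaf => fun S S' => S ==> S'
  | Node _ T1 T2 => fun S S' => subleaf S.1 S'.1 && subleaf S.2 S'.2
  end.

Fixpoint weight T : leafset T -> nat :=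
  match T with
  | Leaf => fun S => S
  | Node _ T1 T2 => fun S => weight S.1 + weight S.2
  end.

Definition only_left v T1 T2 (S : leafset (Node v T1 T2)) :=
  nonempty S.1 && ~~ nonempty S.2.
Definition only_right v T1 T2 (S : leafset (Node v T1 T2)) :=
  ~~ nonempty S.1 && nonempty S.2.

Fixpoint compatible T : leafset T -> leafset T -> bool :=
  match T with
  | Leaf => fun _ _ => true
  | Node _ T1 T2 => fun S' S =>
      [&& compatible S'.1 S.1, compatible S'.2 S.2,
          ~~ (only_left S' && only_right S) & ~~ (only_right S' && only_left S)]
  end.

Fixpoint cost T : leafset T -> leafset T -> nat :=
  match T with
  | Leaf => fun S' S => S' && ~~ S
  | Node _ T1 T2 => fun S' S =>
      cost S'.1 S.1 + cost S'.2 S.2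
      + ((only_left S' && ~~ only_left S) + (only_right S' && ~~ only_right S))
  end.

(** Combinatorial form of lying in a hyperedge of level [j]; [cheap_implic] gives the direction that
    is needed. *)
Definition cheap j T (S' S : leafset T) := compatible S' S && (cost S' S <= j).

Lemma empty_inj T (S' S : leafset T) : ~~ nonempty S' -> ~~ nonempty S -> S' = S.
Proof.
elim: T S' S => [|v T1 IH1 T2 IH2] /=; first by case=> [] [].
move=> [a' b'] [a b] /=; rewrite !negb_or => /andP[ea' eb'] /andP[ea eb].
by rewrite (IH1 a' a) // (IH2 b' b).
Qed.

Lemma subleaf_refl T (S : leafset T) : subleaf S S.
Proof.
elim: T S => [|v T1 IH1 T2 IH2] /=; first by case.
by move=> [a b] /=; rewrite IH1 IH2.
Qed.

Lemma empty_subleaf T (S' S : leafset T) : ~~ nonempty S' -> subleaf S' S.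
Proof.
elim: T S' S => [|v T1 IH1 T2 IH2] /=; first by case.
by move=> [a' b'] [a b] /=; rewrite negb_or => /andP[/IH1-> /IH2->].
Qed.

Lemma leq_weight T (S' S : leafset T) : subleaf S' S -> weight S' <= weight S.
Proof.
elim: T S' S => [|v T1 IH1 T2 IH2] /=; first by case=> [] [].
by move=> [a' b'] [a b] /= /andP[/IH1 ? /IH2 ?]; apply: leq_add.
Qed.

Lemma subleaf_weight_eq T (S' S : leafset T) :
  subleaf S' S -> weight S' = weight S -> S' = S.
Proof.
elim: T S' S => [|v T1 IH1 T2 IH2] /=; first by case=> [] [].
move=> [a' b'] [a b] /= /andP[sa sb] e.
have := leq_weight sa; have := leq_weight sb; move: e.
move: (IH1 _ _ sa) (IH2 _ _ sb).
move: (weight a') (weight b') (weight a) (weight b) => wa' wb' wa wb.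
move=> I1 I2 e lb la; rewrite I1 ?I2 //; clear I1 I2 IH1 IH2; lia.
Qed.

Lemma weight_gt0 T (S : leafset T) : (0 < weight S) = nonempty S.
Proof.
elim: T S => [|v T1 IH1 T2 IH2] /=; first by case.
by move=> [a b] /=; rewrite addn_gt0 IH1 IH2.
Qed.

(** If [S'] meets both subtrees, the budget is shared between them. If it meets one, either [S] also
    misses the other subtree, or the root itself costs one unit. *)
Variant cheap_spec j v T1 T2 (S' S : leafset (Node v T1 T2)) : Prop :=
| CheapBoth j1 j2 of nonempty S'.1 & nonempty S'.2 & j1 + j2 <= j &
    cheap j1 S'.1 S.1 & cheap j2 S'.2 S.2
| CheapLeft of ~~ nonempty S'.2 & nonempty S'.1 & ~~ nonempty S.2 & cheap j S'.1 S.1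
| CheapLeftS j' of ~~ nonempty S'.2 & nonempty S'.1 & j = j'.+1 & cheap j' S'.1 S.1
| CheapRight of ~~ nonempty S'.1 & nonempty S'.2 & ~~ nonempty S.1 & cheap j S'.2 S.2
| CheapRightS j' of ~~ nonempty S'.1 & nonempty S'.2 & j = j'.+1 & cheap j' S'.2 S.2.

Lemma cheapP j v T1 T2 (S' S : leafset (Node v T1 T2)) :
  nonempty S' -> cheap j S' S -> cheap_spec j S' S.
Proof.
case: S' S => [a' b'] [a b] /= ne /andP[/= /and4P[ca cb _ _]].
rewrite /only_left /only_right /=.
move: ne; case na: (nonempty a') => /= nb; last first.
  rewrite nb /=; case ea: (nonempty a) => /= le.
    case: j le => [|j] le; first by lia.
    by apply: CheapRightS; rewrite /= ?na ?nb ?cb /cheap //= cb; lia.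
  by apply: CheapRight; rewrite /= ?na ?nb ?ea /cheap //= cb; lia.
clear nb; case nb: (nonempty b') => /= le.
  by apply: (CheapBoth (j1 := cost a' a) (j2 := cost b' b));
    rewrite /= ?na ?nb /cheap /= ?ca ?cb //; lia.
move: le; case eb: (nonempty b) => /= le.
  case: j le => [|j] le; first by lia.
  by apply: CheapLeftS; rewrite /= ?na ?nb ?ca /cheap //= ca; lia.
by apply: CheapLeft; rewrite /= ?na ?nb ?eb /cheap //= ca; lia.
Qed.

Lemma cheapW j j' T (S' S : leafset T) : j <= j' -> cheap j S' S -> cheap j' S' S.
Proof. by move=> le /andP[c l]; rewrite /cheap c (leq_trans l). Qed.

(** Without budget, [S] must miss every subtree that [S'] misses at a one-sided node, and must
    contain each leaf of [S']; nonemptiness starts the descent. *)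
Lemma cheap0_eq T (S' S : leafset T) : nonempty S' -> cheap 0 S' S -> S' = S.
Proof.
elim: T S' S => [|v T1 IH1 T2 IH2]; first by rewrite /cheap; case=> [] [].
move=> [a' b'] [a b] ne /(cheapP ne); case => //=.
- move=> j1 j2 na nb; rewrite leqn0 addn_eq0 => /andP[/eqP-> /eqP->] na0 nb0.
  by rewrite (IH1 _ _ na na0) (IH2 _ _ nb nb0).
- by move=> eb na eb' /(IH1 _ _ na) ->; rewrite (empty_inj eb eb').
- by move=> eb na eb' /(IH2 _ _ na) ->; rewrite (empty_inj eb eb').
Qed.

(** The single unit is spent in at most one place, and [cheap0_eq] gives equality elsewhere. Spent
    at a leaf it removes that leaf from [S]; spent at a one-sided node it lets [S] grow into the
    other subtree. *)
Lemma cheap1_comparable T (S' S : leafset T) :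
  nonempty S' -> cheap 1 S' S -> subleaf S' S || subleaf S S'.
Proof.
elim: T S' S => [|v T1 IH1 T2 IH2]; first by rewrite /cheap; case=> [] [].
move=> [a' b'] [a b] ne /(cheapP ne); case => /=.
- move=> [|j1] j2 na nb le na0 nb0.
    rewrite (cheap0_eq na na0) subleaf_refl /= IH2 //.
    exact: cheapW nb0.
  have {}le : j1 = 0 /\ j2 = 0 by lia.
  case: le => ? ?; subst.
  by rewrite (cheap0_eq nb nb0) subleaf_refl !andbT IH1.
- by move=> eb na eb' /(IH1 _ _ na); rewrite !(@empty_subleaf T2) // !andbT.
- by move=> j' eb na [<-] /(cheap0_eq na) ->; rewrite subleaf_refl empty_subleaf.
- by move=> eb na eb' /(IH2 _ _ na); rewrite !(@empty_subleaf T1).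
- by move=> j' eb na [<-] /(cheap0_eq na) ->; rewrite subleaf_refl empty_subleaf.
Qed.

(** * Separated families and their combination at a node *)

Variables (I : Type) (D : I -> I -> Prop).

(* The last two clauses strengthen the disjointness so that it passes from
   both subtrees, with one index less, to the whole tree. *)
Definition well_separated j T (s : I -> leafset T) :=
  (forall i, nonempty (s i)) /\
  forall i1 i2, D i1 i2 ->
    [/\ forall S', nonempty S' -> cheap j S' (s i1) -> ~ cheap j S' (s i2),
        ~ cheap j.+1 (s i1) (s i2) & ~ cheap j.+1 (s i2) (s i1)].

Lemma well_separated_node j v T1 T2 (s1 : I -> leafset T1) (s2 : I -> leafset T2) :
  well_separated j s1 -> well_separated j s2 ->
  well_separated j.+1 (fun i => (s1 i, s2 i) : leafset (Node v T1 T2)).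
Proof.
move=> [n1 sep1] [n2 sep2]; split=> [i|i1 i2 Di]; first by rewrite /= n1.
have [d1 f1 g1] := sep1 _ _ Di; have [d2 f2 g2] := sep2 _ _ Di.
(* Every member meets both subtrees, so the budget [j.+2] is shared and at least one half receives
   at most [j.+1]. *)
have far i i' : ~ cheap j.+1 (s1 i) (s1 i') -> ~ cheap j.+1 (s2 i) (s2 i') ->
    ~ cheap j.+2 ((s1 i, s2 i) : leafset (Node v T1 T2)) (s1 i', s2 i').
  move=> h1 h2 /(cheapP (_ : nonempty (_ : leafset (Node v T1 T2)))).
  case=> /=; rewrite ?n1 ?n2 // => j1 j2 _ _ le c1 c2.
  have [l1|l1] := leqP j1 j.+1; first by apply: h1; apply: cheapW c1.
  by apply: h2; apply: cheapW c2; lia.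
split; [|exact: far|exact: far].
move=> [a b] ne /(cheapP ne) c1 /(cheapP ne) c2.
case: c1 c2 => /=.
- move=> j1 j2 na nb le a1 b1; case => /=; rewrite ?na ?nb //.
  move=> j3 j4 _ _ le' a2 b2.
  have [l1|l1] := leqP j1 j.
    have [l3|l3] := leqP j3 j.
      by apply: (d1 a) => //; [apply: cheapW a1|apply: cheapW a2].
    (* The left half uses the whole budget towards [i2], so [b] is exactly [s2 i2]. What remains
       compares [s2 i2] with [s2 i1], which the separation in the right subtree forbids. *)
    have ? : j4 = 0 by move: le' l3; clear; lia.
    subst j4.
    have eb := cheap0_eq nb b2; subst b.
    have [l2|l2] := leqP j2 j.
      by apply: (d2 (s2 i2)) => //; [apply: cheapW b1|apply: cheapW b2].
    have ? : j1 = 0 by move: le l2; clear; lia.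
    subst j1.
    by apply: g2; apply: cheapW b1; lia.
  have ? : j2 = 0 by move: le l1; clear; lia.
  subst j2.
  have eb := cheap0_eq nb b1; subst b.
  by apply: f2; apply: cheapW b2; lia.
(* For a one-sided [(a, b)] the root costs one unit towards both members, since these meet both
   subtrees; the remaining [j] units contradict disjointness in the subtree that is met. *)
- by move=> _ _; rewrite n2.
- move=> j' eb na [<-] a1; case => /=; rewrite ?na ?n2 ?(negPf eb) //.
  by move=> j'' _ _ [<-]; apply: d1.
- by move=> _ _; rewrite n1.
- move=> j' eb na [<-] a1; case => /=; rewrite ?na ?n1 ?(negPf eb) //.
  by move=> j'' _ _ [<-]; apply: d2.
Qed.

End Cost.

(** * Families spread below a fixed depth, and leaf counts of extremal trees *)

Section Spread.
Local Open Scope nat_scope.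
Variable V : Type.
Implicit Type T : tree V.

Fixpoint mask T (a : nat -> bool) : leafset T :=
  match T with
  | Leaf => a 0
  | Node _ T1 T2 => (mask T1 a, mask T2 (fun l => a (nleaves T1 + l)))
  end.

Lemma weight_mask T a : weight (mask T a) = \sum_(l < nleaves T) a l.
Proof.
elim: T a => [|v T1 IH1 T2 IH2] a /=; first by rewrite big_ord1.
by rewrite IH1 IH2 big_split_ord.
Qed.

Lemma mask_inj T a a' : mask T a = mask T a' -> forall l, l < nleaves T -> a l = a' l.
Proof.
elim: T a a' => [|v T1 IH1 T2 IH2] a a' /=; first by move=> e [].
case=> /IH1 e1 /IH2 e2 l lt; case: (ltnP l (nleaves T1)) => [/e1 //|ge].
by have := e2 (l - nleaves T1); rewrite subnKC //; apply; rewrite ltn_subLR.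
Qed.

(** The same mask is used below every node at depth [j], because [well_separated_node] needs a
    common index in both subtrees. The value at a leaf reached too early is a default, excluded by
    [bushy]. *)
Fixpoint spread j T (a : nat -> bool) : leafset T :=
  match j with
  | 0 => mask T a
  | j'.+1 =>
      match T with
      | Leaf => a 0
      | Node _ T1 T2 => (spread j' T1 a, spread j' T2 a)
      end
  end.

Fixpoint bushy j n T : bool :=
  match j with
  | 0 => n <= nleaves T
  | j'.+1 => if T is Node _ T1 T2 then bushy j' n T1 && bushy j' n T2 else false
  end.

Definition charf n (A : {set 'I_n}) (l : nat) : bool :=
  [exists x : 'I_n, (x == l :> nat) && (x \in A)].

Lemma charf_ord n (A : {set 'I_n}) (x : 'I_n) : charf A x = (x \in A).
Proof.
apply/existsP/idP => [[y /andP[/eqP/val_inj -> //]]|xA].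
by exists x; rewrite eqxx.
Qed.

Lemma sum_charf n (A : {set 'I_n}) N : n <= N -> \sum_(l < N) charf A l = #|A|.
Proof.
move=> le; rewrite -(subnKC le) big_split_ord /= [X in _ + X]big1 ?addn0 => [|l _].
  rewrite -sum1_card [RHS]big_mkcond; apply: eq_bigr => x _ /=.
  by rewrite charf_ord; case: (x \in A).
apply/eqP; rewrite eqb0; apply/existsP => -[x /andP[/eqP e _]].
by have := ltn_ord x; rewrite e ltnNge leq_addr.
Qed.

(** All masks have weight [r], so comparable ones coincide; [cheap1_comparable] then excludes cost
    at most one between distinct members, and [cheap0_eq] gives disjointness. *)
Lemma well_separated_mask n r T : 0 < r -> n <= nleaves T ->
  well_separated (fun A B : {A : {set 'I_n} | #|A| == r} => A <> B) 0
    (fun A => mask T (charf (val A))).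
Proof.
move=> r0 le; pose s (A : {A : {set 'I_n} | #|A| == r}) := mask T (charf (val A)).
have ws A : weight (s A) = r.
  by rewrite weight_mask sum_charf //; apply/eqP/(valP A).
have ne A : nonempty (s A) by rewrite -weight_gt0 ws.
have inj : injective s.
  move=> A B /mask_inj e; apply/val_inj/setP => x.
  by rewrite -!charf_ord e // (leq_trans _ le).
have anti A B : A <> B -> ~ cheap 1 (s A) (s B).
  move=> AB /(cheap1_comparable (ne A)) /orP[] /subleaf_weight_eq e;
    by apply: AB; apply: inj; rewrite e ?ws.
split=> // A B AB; split; [|exact: anti|by apply: anti => /esym].
by move=> S' ne' /(cheap0_eq ne') -> /(cheap0_eq (ne A))/inj.
Qed.

Lemma well_separated_spread j n r T : 0 < r -> bushy j n T ->
  well_separated (fun A B : {A : {set 'I_n} | #|A| == r} => A <> B) j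
    (fun A => spread j T (charf (val A))).
Proof.
move=> r0; elim: j T => [|j IHj] T /=; first exact: well_separated_mask.
by case: T => //= v T1 T2 /andP[b1 b2]; apply: well_separated_node; apply: IHj.
Qed.

(** Pascal recursion for $\sum_{i \le k} \binom{h}{i}$, the largest number of leaves for height at
    most [h] and Horton-Strahler number at most [k]. *)
Fixpoint maxleaves h k : nat :=
  if h is h'.+1 then if k is k'.+1 then maxleaves h' k' + maxleaves h' k else 1
  else 1.

Lemma maxleaves_gt0 h k : 0 < maxleaves h k.
Proof. by elim: h k => [|h IHh] [|k] //=; rewrite addn_gt0 IHh. Qed.

Lemma maxleaves_ge h k : h < maxleaves h k.+1.
Proof.
elim: h => [//|h IHh] /=.
exact: leq_add (maxleaves_gt0 h k) IHh.
Qed.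

Lemma hts_node k v T1 T2 : hts (Node v T1 T2) <= k ->
  exists2 k', k = k'.+1 & (hts T1 <= k' /\ hts T2 <= k) \/ (hts T1 <= k /\ hts T2 <= k').
Proof.
rewrite /=; move: (hts T1) (hts T2) => x y; case: eqP => xy le.
  by case: k le => // k le; exists k => //; left; rewrite xy in le *; lia.
case: k le => [|k] le; first by lia.
by exists k => //; lia.
Qed.

Lemma nleaves_max h k T : hts T <= k -> height T <= h -> nleaves T <= maxleaves h k.
Proof.
elim: T h k => [|v T1 IH1 T2 IH2] h k; first by rewrite maxleaves_gt0.
move=> /hts_node[k' -> hk]; case: h => // h; rewrite [height _]/= ltnS geq_max.
move=> /andP[h1 h2] /=; case: hk => [] [k1 k2]; first by apply: leq_add; auto.
by rewrite addnC; apply: leq_add; auto.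
Qed.

(** A maximal leaf count forces both subtrees to be maximal for their own bounds. At depth [j] the
    height bound is still [h - j] and the Horton-Strahler bound is positive, so [maxleaves_ge]
    applies. *)
Lemma bushy_max j h k T : hts T <= k -> height T <= h -> nleaves T = maxleaves h k ->
  j < k -> j < h -> bushy j (h - j).+1 T.
Proof.
elim: j h k T => [|j IHj] h k T hk hh e jk jh.
  by rewrite /= subn0 e; case: k jk {hk e} => // k _; apply: maxleaves_ge.
(* A single leaf is not maximal here, since [maxleaves] is at least 2 when both bounds are
   positive. *)
case: T hk hh e => [|v T1 T2] /= hk hh e.
  case: h k jk jh {hk hh} e => [|h] [|k] //= _ _.
  by have := maxleaves_gt0 h k; have := maxleaves_gt0 h k.+1; lia.
move/(hts_node (v := v)): hk jk e => [k' -> hk] jk e; case: h jh hh e => [//|h] jh.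
rewrite ltnS geq_max => /andP[h1 h2] /= e; rewrite subSS.
case: hk => -[k1 k2].
  have l1 := nleaves_max k1 h1; have l2 := nleaves_max k2 h2.
  by apply/andP; split; [apply: (IHj h k')|apply: (IHj h k'.+1)] => //; lia.
have l1 := nleaves_max k1 h1; have l2 := nleaves_max k2 h2.
by apply/andP; split; [apply: (IHj h k'.+1)|apply: (IHj h k')] => //; lia.
Qed.

Lemma nnodes_nleaves T : (nnodes T).+1 = (nleaves T).*2.
Proof. by elim: T => //= v T1 IH1 T2 IH2; lia. Qed.

End Spread.

(** Extremality compares with actual trees only, so the upper bound on leaves has to be realised by
    one. *)
Lemma maxleaves_attained h k : exists T : tree unit,
  [/\ (hts T <= k)%N, (height T <= h)%N & nleaves T = maxleaves h k].
Proof.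
elim: h k => [|h IHh] [|k]; try by exists Leaf.
have [T1 [k1 h1 e1]] := IHh k; have [T2 [k2 h2 e2]] := IHh k.+1.
exists (Node tt T1 T2) => /=; rewrite e1 e2; split=> //; last by rewrite ltnS geq_max h1.
by case: eqP => _; rewrite ?ltnS // geq_max k2 (leq_trans k1).
Qed.

Lemma extremal_bushy (V : Type) (T : tree V) k h j :
  extremal k h T -> (j < k)%N -> (j < h)%N -> bushy j (h - j).+1 T.
Proof.
move=> [hk hh ext]; apply: bushy_max; rewrite ?hk ?hh //.
apply/eqP; rewrite eqn_leq nleaves_max ?hk ?hh //=.
have [T' [k' h' <-]] := maxleaves_attained h k.
have := ext _ k' h'; have := nnodes_nleaves T; have := nnodes_nleaves T'; lia.
Qed.

(** * Prime implicates of doped tree clause-sets *)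

Section Implicates.
Local Open Scope nat_scope.
Local Open Scope fset_scope.
Variable V : choiceType.
Implicit Types (T : tree V) (u : {fset literal V} -> V).

(** The clauses of a subtree lack the edge label at the root; restoring it makes [u] a doping of the
    subtree. *)
Definition shift u l : {fset literal V} -> V := fun C => u (l |` C).

(* By [prime_implicP] and [prime_implic], these are, for nonempty S,
   exactly the prime implicates of the doped clause-set: the doping variables
   of the leaves in S and the literals pure in the clauses of these leaves. *)
Fixpoint implic T u : leafset T -> {fset literal V} :=
  match T return leafset T -> _ with
  | Leaf => fun S => [fset l in [:: (u fset0, true)] | S]
  | Node v T1 T2 => fun S =>
      implic (shift u (v, true)) S.1 `|` implic (shift u (v, false)) S.2
      `|` ([fset l in [:: (v, true)] | only_left S]
      `|` [fset l in [:: (v, false)] | only_right S])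
  end.

Lemma in_implic_node v T1 T2 u (S : leafset (Node v T1 T2)) l :
  (l \in implic u S) =
  [|| l \in implic (shift u (v, true)) S.1, l \in implic (shift u (v, false)) S.2,
      (l == (v, true)) && only_left S | (l == (v, false)) && only_right S].
Proof. by rewrite /= !inE -!orbA. Qed.

(** The labelling and doping conditions in a form that both subtrees inherit under [shift]. *)
Record dopable T u : Prop := Dopable {
  dopable_uniq : uniq (labels T);
  dopable_inj : {in F1 T &, injective u};
  dopable_new : {in F1 T, forall C, u C \notin labels T}
}.

Lemma F1_left v T1 T2 C : C \in F1 T1 -> (v, true) |` C \in F1 (Node v T1 T2).
Proof. by move=> CT; apply/fsetUP; left; apply/imfsetP; exists C. Qed.

Lemma F1_right v T1 T2 C : C \in F1 T2 -> (v, false) |` C \in F1 (Node v T1 T2).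
Proof. by move=> CT; apply/fsetUP; right; apply/imfsetP; exists C. Qed.

Lemma F1_labels T C l : C \in F1 T -> l \in C -> l.1 \in labels T.
Proof.
elim: T C => [|v T1 IH1 T2 IH2] C /=; first by rewrite inE => /eqP ->.
rewrite in_cons mem_cat => /fsetUP[] /imfsetP[/= C' C'T ->] /fset1UP[-> |lC'];
  by rewrite ?eqxx //= ?(IH1 _ C'T) ?(IH2 _ C'T) ?orbT.
Qed.

Lemma labels_var T x : x \in labels T -> x \in var (F1 T).
Proof.
have F1_neq0 T' : exists C, C \in F1 T'.
  elim: T' => [|v T1 [C CT] T2 _]; first by exists fset0; rewrite inE.
  by exists ((v, true) |` C); apply: F1_left.
have varP T' C l : C \in F1 T' -> l \in C -> l.1 \in var (F1 T').
  move=> CT lC; apply/bigfcupP; exists C; first by rewrite CT.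
  by apply/imfsetP; exists l.
elim: T => [//|v T1 IH1 T2 IH2].
rewrite /= in_cons mem_cat => /or3P[/eqP -> | /IH1 | /IH2].
- by have [C /(F1_left v T2) CT] := F1_neq0 T1;
    apply: (varP _ _ (v, true) CT); rewrite !inE eqxx.
- move=> /bigfcupP[C /andP[CT _] /imfsetP[l lC ->]].
  by apply: (varP _ _ _ (F1_left v T2 CT)); rewrite inE lC orbT.
- move=> /bigfcupP[C /andP[CT _] /imfsetP[l lC ->]].
  by apply: (varP _ _ _ (F1_right v T1 CT)); rewrite inE lC orbT.
Qed.

Lemma dopableP T u : uniq (labels T) -> doping_vars (F1 T) u -> dopable T u.
Proof.
move=> uT [inj new]; split=> // C CT; apply: contra (new _ CT); exact: labels_var.
Qed.

Lemma fset1U_inj (l : literal V) C C' : l \notin C -> l \notin C' -> l |` C = l |` C' -> C = C'.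
Proof. by move=> lC lC' e; rewrite -(fsetU1K lC) e fsetU1K. Qed.

Lemma dopable_left v T1 T2 u : dopable (Node v T1 T2) u -> dopable T1 (shift u (v, true)).
Proof.
case=> /= /andP[]; rewrite mem_cat negb_or cat_uniq => /andP[v1 v2].
move=> /and3P[u1 _ _] inj new; split=> // [C C' CT C'T|C CT].
  move/(inj _ _ (F1_left v T2 CT) (F1_left v T2 C'T)); apply: fset1U_inj.
    by apply: contra v1 => /(F1_labels CT).
  by apply: contra v1 => /(F1_labels C'T).
by have := new _ (F1_left v T2 CT); rewrite inE mem_cat !negb_or => /and3P[].
Qed.

Lemma dopable_right v T1 T2 u : dopable (Node v T1 T2) u -> dopable T2 (shift u (v, false)).
Proof.
case=> /= /andP[]; rewrite mem_cat negb_or cat_uniq => /andP[v1 v2].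
move=> /and3P[_ _ u2] inj new; split=> // [C C' CT C'T|C CT].
  move/(inj _ _ (F1_right v T1 CT) (F1_right v T1 C'T)); apply: fset1U_inj.
    by apply: contra v2 => /(F1_labels CT).
  by apply: contra v2 => /(F1_labels C'T).
by have := new _ (F1_right v T1 CT); rewrite inE mem_cat !negb_or => /and3P[].
Qed.

Lemma implic_lit T u (S : leafset T) l : l \in implic u S ->
  l.1 \in labels T \/ exists2 C, C \in F1 T & l = (u C, true).
Proof.
elim: T u S => [|v T1 IH1 T2 IH2] u S.
  by rewrite !inE => /andP[/eqP -> _]; right; exists fset0; rewrite ?inE.
rewrite in_implic_node /= in_cons mem_cat;
case/or4P => [/IH1|/IH2|/andP[/eqP -> _]|/andP[/eqP -> _]].
- case=> [->|[C CT ->]]; [by left; rewrite orbT|right].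
  by exists ((v, true) |` C); first exact: F1_left.
- case=> [->|[C CT ->]]; [by left; rewrite !orbT|right].
  by exists ((v, false) |` C); first exact: F1_right.
- by left; rewrite eqxx.
- by left; rewrite eqxx.
Qed.

Lemma implic_left_neq v T1 T2 u (S : leafset T1) l : dopable (Node v T1 T2) u ->
  l \in implic (shift u (v, true)) S -> l.1 != v.
Proof.
case=> /= /andP[]; rewrite mem_cat negb_or => /andP[v1 v2] _ inj new.
move=> /implic_lit[lT|[C CT ->]]; first by apply: contraNneq v1 => <-.
by have := new _ (F1_left v T2 CT); rewrite inE negb_or => /andP[].
Qed.

Lemma implic_right_neq v T1 T2 u (S : leafset T2) l : dopable (Node v T1 T2) u ->
  l \in implic (shift u (v, false)) S -> l.1 != v.
Proof.
case=> /= /andP[]; rewrite mem_cat negb_or => /andP[v1 v2] _ inj new.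
move=> /implic_lit[lT|[C CT ->]]; first by apply: contraNneq v2 => <-.
by have := new _ (F1_right v T1 CT); rewrite inE negb_or => /andP[].
Qed.

Lemma implic_left_right_neq v T1 T2 u (S1 : leafset T1) (S2 : leafset T2) l1 l2 :
  dopable (Node v T1 T2) u ->
  l1 \in implic (shift u (v, true)) S1 -> l2 \in implic (shift u (v, false)) S2 ->
  l1.1 != l2.1.
Proof.
case=> /= /andP[]; rewrite mem_cat negb_or cat_uniq => /andP[v1 v2].
move=> /and3P[_ /hasPn u12 _] inj new.
case/implic_lit=> [lT1|[C CT ->]]; case/implic_lit=> [lT2|[C' C'T ->]] /=.
- by apply: contraTneq lT1 => ->; apply: u12.
- have := new _ (F1_right v T1 C'T); rewrite inE mem_cat !negb_or => /and3P[_ n _].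
  by apply: contraNneq n => e; rewrite e in lT1.
- have := new _ (F1_left v T2 CT); rewrite inE mem_cat !negb_or => /and3P[_ _ n].
  by apply: contraNneq n => e; rewrite -e in lT2.
(* Equal doping variables would identify a left with a right clause, but [(v, true)] occurs only in
   the former. *)
- apply/eqP => /(inj _ _ (F1_left v T2 CT) (F1_right v T1 C'T)) e.
  have : (v, true) \in (v, false) |` C' by rewrite -e !inE eqxx.
  by move=> /fset1UP[//|/(F1_labels C'T)]; rewrite (negPf v2).
Qed.

Lemma implic_clause T u (S : leafset T) : dopable T u -> is_clause (implic u S).
Proof.
elim: T u S => [|v T1 IH1 T2 IH2] u S dop l.
  by rewrite !inE => /andP[/eqP -> _]; rewrite /compl /= xpair_eqE andbF.
have dop1 := dopable_left dop; have dop2 := dopable_right dop.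
rewrite !in_implic_node !negb_or => lS.
have nv : l.1 != v -> (compl l != (v, true)) && (compl l != (v, false)).
  by move=> n; rewrite /compl !xpair_eqE !(negPf n).
case/or4P: lS => [l1|l2|/andP[/eqP -> ol]|/andP[/eqP -> ol]].
- have /nv/andP[/negPf-> /negPf->] := implic_left_neq dop l1.
  rewrite (IH1 _ _ dop1) //= andbT; apply/negP => l2.
  by have := implic_left_right_neq dop l1 l2; rewrite eqxx.
- have /nv/andP[/negPf-> /negPf->] := implic_right_neq dop l2.
  rewrite (IH2 _ _ dop2) //= !andbT; apply/negP => l1.
  by have := implic_left_right_neq dop l1 l2; rewrite eqxx.
- have n1 : (v, false) \notin implic (shift u (v, true)) S.1.
    by apply/negP => /(implic_left_neq dop); rewrite eqxx.
  have n2 : (v, false) \notin implic (shift u (v, false)) S.2.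
    by apply/negP => /(implic_right_neq dop); rewrite eqxx.
  rewrite /compl /= n1 n2 xpair_eqE andbF eqxx /=.
  by move: ol; rewrite /only_left /only_right => /andP[-> _].
- have n1 : (v, true) \notin implic (shift u (v, true)) S.1.
    by apply/negP => /(implic_left_neq dop); rewrite eqxx.
  have n2 : (v, true) \notin implic (shift u (v, false)) S.2.
    by apply/negP => /(implic_right_neq dop); rewrite eqxx.
  rewrite /compl /= n1 n2 !xpair_eqE !eqxx /=.
  by move: ol; rewrite /only_left /only_right => /andP[/negPf-> _].
Qed.

Definition sat_doping T u (f : V -> bool) : Prop :=
  forall C, C \in F1 T -> satisfies f (C `|` [fset (u C, true)]).

Lemma entails_dopingP T u C :
  entails (doping u (F1 T)) C <-> forall f, sat_doping T u f -> satisfies f C.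
Proof.
split=> ent f sat; apply: ent.
  by move=> D /imfsetP[C' C'T ->]; apply: sat.
by move=> C' C'T; apply: sat; apply/imfsetP; exists C'.
Qed.

(** If [f] sets the root variable to true, it has to satisfy the right-hand clauses without their
    root literal. Either [S] meets the right subtree and induction applies, or [S] is left-only and
    the pure root literal is satisfied; the other value is symmetric. *)
Lemma satisfies_implic T u (S : leafset T) f :
  nonempty S -> sat_doping T u f -> satisfies f (implic u S).
Proof.
elim: T u S => [|v T1 IH1 T2 IH2] u S ne sat.
  have [|l] := sat fset0; first by rewrite inE.
  by rewrite fset0U inE => /eqP -> fl; exists (u fset0, true); rewrite // !inE eqxx.
case fv: (f v).
  have sat2 : sat_doping T2 (shift u (v, false)) f.
    move=> C CT; have [l] := sat _ (F1_right v T1 CT).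
    rewrite -fsetUA => /fset1UP[-> /=|lC fl]; first by rewrite fv.
    by exists l.
  case n2: (nonempty S.2).
    have [l lS fl] := IH2 _ _ n2 sat2.
    by exists l; rewrite // in_implic_node lS orbT.
  exists (v, true) => //; rewrite in_implic_node eqxx /only_left n2 andbT /=.
  by move: ne; rewrite /= n2 orbF => ->; rewrite !orbT.
have sat1 : sat_doping T1 (shift u (v, true)) f.
  move=> C CT; have [l] := sat _ (F1_left v T2 CT).
  rewrite -fsetUA => /fset1UP[-> /=|lC fl]; first by rewrite fv.
  by exists l.
case n1: (nonempty S.1).
  have [l lS fl] := IH1 _ _ n1 sat1.
  by exists l; rewrite // in_implic_node lS.
exists (v, false) => //; rewrite in_implic_node eqxx /only_right n1 /=.
by move: ne; rewrite /= n1 => /= ->; rewrite !orbT.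
Qed.

Definition upd (f : V -> bool) v b x := if x == v then b else f x.

Lemma implic0 T u (S : leafset T) : ~~ nonempty S -> implic u S = fset0.
Proof.
elim: T u S => [|v T1 IH1 T2 IH2] u S /=.
  by move=> /negPf ->; apply/fsetP => l; rewrite !inE andbF.
rewrite negb_or => /andP[e1 e2]; rewrite IH1 // IH2 //.
by apply/fsetP => l; rewrite /only_left /only_right !inE (negPf e1) (negPf e2) !andbF.
Qed.

Lemma sat_doping_upd T u f v b :
  v \notin labels T -> {in F1 T, forall C, u C != v} ->
  sat_doping T u f -> sat_doping T u (upd f v b).
Proof.
move=> vT uv sat C CT; have [l lC fl] := sat _ CT; exists l => //.
rewrite /upd ifN //; case/fsetUP: lC => [lC|]; last by rewrite inE => /eqP ->; apply: uv.
by apply: contraNneq vT => <-; apply: F1_labels lC.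
Qed.

Fixpoint no_leaf T : leafset T :=
  match T with Leaf => false | Node _ T1 T2 => (no_leaf T1, no_leaf T2) end.

Lemma nonempty_no_leaf T : nonempty (no_leaf T) = false.
Proof. by elim: T => //= v T1 -> T2 ->. Qed.

(** Fixing the root variable satisfies all clauses on one side. If this value does not help to
    satisfy [C], then the doped clauses of the other side already entail [C]. *)
Lemma entailed_implic_sub T u C : dopable T u -> is_clause C ->
  (forall f, sat_doping T u f -> satisfies f C) ->
  exists2 S : leafset T, nonempty S & implic u S `<=` C.
Proof.
move=> dop clC; elim: T u dop => [|v T1 IH1 T2 IH2] u dop ent.
  (* This falsifies every literal of [C] except possibly the positive doping literal, which must
     therefore lie in [C]. *)
  pose f x := (x == u fset0) || ((x, false) \in C).
  have [|l lC fl] := ent f.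
    by move=> D; rewrite inE => /eqP ->; exists (u fset0, true); rewrite ?inE ?eqxx /f ?eqxx.
  have := clC _ lC; move: fl lC; rewrite /f /compl; case: l => x [] /=.
    case/orP => [/eqP -> uC _|-> //]; exists true => //.
    by apply/fsubsetP => y; rewrite !inE => /andP[/eqP ->].
  by move/negbT; rewrite negb_or => /andP[_ /negPf ->].
have dop1 := dopable_left dop; have dop2 := dopable_right dop.
have [/andP[]] := dopable_uniq dop; rewrite mem_cat negb_or => /andP[v1 v2] _.
have uv1 : {in F1 T1, forall D, shift u (v, true) D != v}.
  by move=> D DT; have := dopable_new dop (F1_left v T2 DT); rewrite inE negb_or => /andP[].
have uv2 : {in F1 T2, forall D, shift u (v, false) D != v}.
  by move=> D DT; have := dopable_new dop (F1_right v T1 DT); rewrite inE negb_or => /andP[].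
have left : (v, false) \notin C ->
    exists2 S : leafset T1, nonempty S & implic (shift u (v, true)) S `<=` C.
  move=> vC; apply: IH1 => // f sat.
  have [|l lC fl] := ent (upd f v false).
    move=> D /fsetUP[] /imfsetP[/= E ET ->]; last first.
      by exists (v, false); rewrite ?inE ?eqxx // /upd eqxx.
    have [l lE fl] := sat_doping_upd false v1 uv1 sat ET.
    by exists l; rewrite // -fsetUA inE lE orbT.
  exists l => //; move: fl; rewrite /upd; case: eqP => // lv lf.
  by case/negP: vC; rewrite -lv lf; case: (l) lC.
have right : (v, true) \notin C ->
    exists2 S : leafset T2, nonempty S & implic (shift u (v, false)) S `<=` C.
  move=> vC; apply: IH2 => // f sat.
  have [|l lC fl] := ent (upd f v true).
    move=> D /fsetUP[] /imfsetP[/= E ET ->].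
      by exists (v, true); rewrite ?inE ?eqxx // /upd eqxx.
    have [l lE fl] := sat_doping_upd true v2 uv2 sat ET.
    by exists l; rewrite // -fsetUA inE lE orbT.
  exists l => //; move: fl; rewrite /upd; case: eqP => // lv lf.
  by case/negP: vC; rewrite -lv lf; case: (l) lC.
(* A root literal in [C] may be pure in the implicate, so one subtree suffices; if [C] has neither
   root literal, leaves from both subtrees are taken to avoid one. *)
have [pC|pC] := boolP ((v, true) \in C).
  have [S1 n1 /fsubsetP sub1] := left (clC _ pC).
  exists (S1, no_leaf T2); first by rewrite /= n1.
  apply/fsubsetP => l; rewrite in_implic_node /only_left /only_right /= nonempty_no_leaf n1.
  rewrite (implic0 _ (negbT (nonempty_no_leaf T2))) inE /= andbF orbF andbT.
  by case/orP => [/sub1|/eqP ->].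
have [S2 n2 /fsubsetP sub2] := right pC.
have [nC|nC] := boolP ((v, false) \in C).
  exists (no_leaf T1, S2); first by rewrite /= n2 orbT.
  apply/fsubsetP => l; rewrite in_implic_node /only_left /only_right /= nonempty_no_leaf n2.
  rewrite (implic0 _ (negbT (nonempty_no_leaf T1))) inE /= andbF andbT.
  by case/orP => [/sub2|/eqP ->].
have [S1 n1 /fsubsetP sub1] := left nC.
exists (S1, S2); first by rewrite /= n1.
apply/fsubsetP => l; rewrite in_implic_node /only_left /only_right /= n1 n2 !andbF !orbF.
by case/orP => [/sub1|/sub2].
Qed.

Lemma compatible_implic T u (S' S : leafset T) :
  (forall l, l \in implic u S' -> compl l \notin implic u S) -> compatible S' S.
Proof.
elim: T u S' S => [//|v T1 IH1 T2 IH2] u S' S nc /=; apply/and4P; split.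
- apply: (IH1 (shift u (v, true))) => l lS; have := nc l.
  by rewrite !in_implic_node lS => /(_ isT); rewrite negb_or => /andP[].
- apply: (IH2 (shift u (v, false))) => l lS; have := nc l.
  by rewrite !in_implic_node lS orbT => /(_ isT); rewrite !negb_or => /and3P[].
- apply/negP => /andP[l r]; have := nc (v, true).
  by rewrite !in_implic_node /compl l r !eqxx !orbT => /(_ isT).
- apply/negP => /andP[l r]; have := nc (v, false).
  by rewrite !in_implic_node /compl l r !eqxx !orbT => /(_ isT).
Qed.

Lemma card_fdisjointU (K : choiceType) (A B : {fset K}) :
  [disjoint A & B] -> #|` A `|` B| = (#|` A| + #|` B|)%N.
Proof. by rewrite -fsetI_eq0 => /eqP e; rewrite cardfsU e cardfs0 subn0. Qed.

(** The parts from the left subtree, the right subtree and the root use different variables, so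
    their contributions are disjoint and add up. *)
Lemma cost_leq_card T u (S' S : leafset T) : dopable T u ->
  cost S' S <= #|` implic u S' `\` implic u S|.
Proof.
elim: T u S' S => [|v T1 IH1 T2 IH2] u S' S dop.
  case: S' S => [] [] //=.
  rewrite (_ : _ `\` _ = [fset (u fset0, true)]) ?cardfs1 //.
  by apply/fsetP => l; rewrite !inE andbF andbT.
have dop1 := dopable_left dop; have dop2 := dopable_right dop.
set u1 := shift u (v, true); set u2 := shift u (v, false).
pose A := implic u1 S'.1 `\` implic u1 S.1.
pose B := implic u2 S'.2 `\` implic u2 S.2.
pose X := [fset l in [:: (v, true)] | only_left S' && ~~ only_left S].
pose Y := [fset l in [:: (v, false)] | only_right S' && ~~ only_right S].
have card1 (l : literal V) (b : bool) : #|` [fset x in [:: l] | b]| = b.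
  case: b; last by rewrite (_ : [fset _ in _ | _] = fset0) ?cardfs0 //;
    apply/fsetP => x; rewrite !inE andbF.
  by rewrite (_ : [fset _ in _ | _] = [fset l]) ?cardfs1 //;
    apply/fsetP => x; rewrite !inE andbT.
have neq1 l : l \in A -> l.1 != v by case/fsetDP => /(implic_left_neq dop).
have neq2 l : l \in B -> l.1 != v by case/fsetDP => /(implic_right_neq dop).
have eqXY l : l \in X `|` Y -> l.1 = v.
  by case/fsetUP; rewrite !inE => /andP[/eqP -> _].
have dAB : [disjoint A & B].
  apply/fdisjointP => l /fsetDP[l1 _]; apply/negP => /fsetDP[l2 _].
  by have := implic_left_right_neq dop l1 l2; rewrite eqxx.
have dXY : [disjoint X & Y].
  by apply/fdisjointP => l; rewrite !inE => /andP[/eqP -> _]; rewrite xpair_eqE andbF.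
have dABXY : [disjoint A `|` B & X `|` Y].
  apply/fdisjointP => l lAB; apply/negP => /eqXY lv.
  by case/fsetUP: lAB => [/neq1|/neq2]; rewrite lv eqxx.
apply: (@leq_trans #|` (A `|` B) `|` (X `|` Y)|).
  rewrite !card_fdisjointU // !card1; apply: leq_add => //; apply: leq_add.
    exact: IH1.
  exact: IH2.
apply: fsubset_leq_card; apply/fsubsetP => l lU; apply/fsetDP.
rewrite !in_implic_node; case/fsetUP: lU => [/fsetUP[]|] lU.
- have nv b : (l == (v, b)) = false.
    by apply: contraNF (neq1 _ lU) => /eqP ->.
  case/fsetDP: lU => l1 l1'; split; first by rewrite l1.
  rewrite (negPf l1') !nv /= !orbF; apply/negP => l2.
  by have := implic_left_right_neq dop l1 l2; rewrite eqxx.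
- have nv b : (l == (v, b)) = false.
    by apply: contraNF (neq2 _ lU) => /eqP ->.
  case/fsetDP: lU => l2 l2'; split; first by rewrite l2 orbT.
  rewrite (negPf l2') !nv /= !orbF; apply/negP => l1.
  by have := implic_left_right_neq dop l1 l2; rewrite eqxx.
have lv := eqXY _ lU.
have /negPf n1 : l \notin implic u1 S.1.
  by apply/negP => /(implic_left_neq dop); rewrite lv eqxx.
have /negPf n2 : l \notin implic u2 S.2.
  by apply/negP => /(implic_right_neq dop); rewrite lv eqxx.
rewrite n1 n2 /=; case/fsetUP: lU; rewrite !inE => /andP[/eqP -> /andP[-> /negPf ->]];
  by rewrite !xpair_eqE !eqxx /= ?orbT.
Qed.

Lemma cheap_implic T u (S' S : leafset T) j : dopable T u ->
  (forall l, l \in implic u S' -> compl l \notin implic u S) ->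
  #|` implic u S' `\` implic u S| <= j -> cheap j S' S.
Proof.
move=> dop nc le; rewrite /cheap (compatible_implic nc).
exact: leq_trans (cost_leq_card _ _ dop) le.
Qed.

(** For minimality, an implicate inside that of [S] contains the one of some nonempty [S']; its cost
    relative to [S] is zero, so [S'] equals [S]. *)
Lemma prime_implic T u (S : leafset T) : dopable T u -> nonempty S ->
  prime_implicate (doping u (F1 T)) (implic u S).
Proof.
move=> dop ne; split; first exact: implic_clause.
  by apply/entails_dopingP => f; apply: satisfies_implic.
move=> C clC /entails_dopingP ent subC.
have [S' ne' subS'] := entailed_implic_sub dop clC ent.
have sub := fsubset_trans subS' subC.
suff e : S' = S by apply/eqP; rewrite eqEfsubset subC -e.
apply: (cheap0_eq ne'); apply: (cheap_implic dop).
  by move=> l /(fsubsetP sub); apply: (implic_clause dop).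
by move: sub; rewrite -fsetD_eq0 => /eqP ->; rewrite cardfs0.
Qed.

Lemma prime_implicP T u C : dopable T u -> prime_implicate (doping u (F1 T)) C ->
  exists2 S : leafset T, nonempty S & C = implic u S.
Proof.
move=> dop [clC /entails_dopingP ent min].
have [S ne sub] := entailed_implic_sub dop clC ent; exists S => //.
have [cl ent' _] := prime_implic dop ne.
by rewrite (min _ cl ent' sub).
Qed.

(** * From separated families to matchings of the trigger hypergraph *)

Lemma in_trigger_edge k (F : {fset {fset literal V}}) C C' :
  (C' \in trigger_edge k F C) =
  [&& C' \in prc0 F, C' `&` [fset compl l | l in C] == fset0 & #|` C' `\` C| <= k].
Proof. by rewrite !inE. Qed.

Lemma matching_number_well_separated (I : finType) k T u (s : I -> leafset T) :
  dopable T u -> well_separated (fun i j => i <> j) k s ->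
  #|I| <= matching_number (trigger_hypergraph k (doping u (F1 T))).
Proof.
move=> dop [ne sep]; set F := doping u (F1 T).
pose E i := trigger_edge k F (implic u (s i)).
have primeE i : implic u (s i) \in prc0 F by apply/prc0P/prime_implic.
have memE i : implic u (s i) \in E i.
  rewrite in_trigger_edge primeE fsetDv cardfs0 andbT /=; apply/eqP/fsetP => l.
  rewrite !inE; apply/negP => /andP[lS /imfsetP[/= l' l'S e]].
  by have := implic_clause dop l'S; rewrite -e lS.
have disjE i i' : i != i' -> [disjoint E i & E i'].
  move=> /eqP /sep [dis _ _]; apply/fdisjointP => C.
  rewrite (in_trigger_edge k F (implic u (s i))) => /and3P[/prc0P pC c1 l1].
  apply/negP; rewrite (in_trigger_edge k F (implic u (s i'))) => /and3P[_ c2 l2].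
  have [S neS eC] := prime_implicP dop pC; subst C.
  have cheapE i0 : implic u S `&` [fset compl l | l in implic u (s i0)] == fset0 ->
      #|` implic u S `\` implic u (s i0)| <= k -> cheap k S (s i0).
    move=> /eqP c le; apply: (cheap_implic dop) le => l lS; apply/negP => cl.
    suff : l \in fset0 by rewrite inE.
    rewrite -c inE lS /=; apply/imfsetP; exists (compl l) => //.
    by case: (l) => x b; rewrite /compl /= negbK.
  by apply: (dis S neS); apply: cheapE.
(* Each hyperedge contains its own centre, so disjoint ones are distinct and the matching has as
   many edges as there are indices. *)
have injE : injective E.
  move=> i i' e; apply: contraTeq isT => ne'; have := disjE _ _ ne'.
  by rewrite -e => /fdisjointP /(_ _ (memE i)); rewrite memE.
pose M := [fset E i | i in I].
have cardM : #|` M| = #|I|.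
  by rewrite card_imfset //= cardE.
rewrite -cardM; apply: (@bigmaxn_sup_seq _ _ M) => //.
  rewrite fpowersetE; apply/fsubsetP => _ /imfsetP[i _ ->].
  by apply/imfsetP; exists (implic u (s i)).
apply/trivIfsetP => _ _ /imfsetP[i _ ->] /imfsetP[i' _ ->] neq.
by apply: disjE; apply: contraNneq neq => ->.
Qed.

End Implicates.

(** * Estimates for the central binomial coefficient *)

Section Asymptotics.

(** A step of two keeps the parity of the upper index, so even and odd central coefficients can be
    treated by separate inductions. *)
Lemma bin_step n r : (r <= n ->
  r.+1 * (n - r).+1 * 'C(n.+2, r.+1) = n.+2 * n.+1 * 'C(n, r))%N.
Proof.
move=> rn; have := mul_bin_down n.+1 r; have := mul_bin_diag n.+2 r.
rewrite subSn //= => e1 e2.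
by rewrite mulnAC -e1 -mulnA (mulnC 'C(_, _)) -e2 mulnA.
Qed.

(** The ratio [Y / X] is [L / K]; if it is at least $16 = 4^2$, it keeps pace with $4^m$ when $m$
    grows by two. *)
Lemma bound_step (K L X Y P : nat) :
  (0 < K -> K * Y = L * X -> 16 * K <= L -> P < X -> 16 * P < Y)%N.
Proof.
move=> K0 e KL PX; rewrite -(ltn_pmul2l K0) e.
apply: (@leq_trans (16 * K * X)); last by rewrite leq_mul2r KL orbT.
by rewrite mulnA (mulnC K) ltn_pmul2l // muln_gt0.
Qed.

(** The induction starts at $m = 6$ with $4096 < 20^2 \cdot 12 = 4800$. With $s = r + 3$, the growth
    factor is $4(2s+1)^2 / (s(s+1)) > 16$. *)
Lemma central_bin_lower_even r :
  (4 ^ (2 * r.+3) < 'C(2 * r.+3, r.+3) ^ 2 * (2 * (2 * r.+3)))%N.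
Proof.
elim: r => [|r IH]; first by rewrite !binS !bin0.
rewrite (_ : 2 * r.+4 = (2 * r.+3).+2)%N; last by lia.
rewrite 2!expnS mulnA (_ : 4 * 4 = 16)%N //.
have := @bin_step (2 * r.+3) r.+3; rewrite (_ : 2 * r.+3 - r.+3 = r.+3)%N; last by lia.
move: IH; move: 'C(_, _) 'C(_, _) (4 ^ _)%N => E' E P IH e.
have {}e : (r.+4 * E' = 2 * (2 * r.+3).+1 * E)%N.
  apply/eqP; rewrite -(@eqn_pmul2l r.+4) // mulnA e; last by lia.
  by apply/eqP; lia.
have e2 : (r.+4 ^ 2 * E' ^ 2 = 4 * (2 * r.+3).+1 ^ 2 * E ^ 2)%N.
  by rewrite -expnMn e !expnMn.
apply: (bound_step (K := r.+4 * r.+3) (L := 4 * (2 * r.+3).+1 ^ 2) _ _ _ IH).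
- by rewrite muln_gt0.
- transitivity (4 * r.+3 * (r.+4 ^ 2 * E' ^ 2))%N; last by rewrite e2; clear; lia.
  by clear; lia.
- by clear; lia.
Qed.

(** The induction starts at $m = 7$ with $16384 < 35^2 \cdot 14 = 17150$. With $s = r + 3$, the
    growth factor is $4(2s+3)^3 / ((s+2)^2(2s+1)) > 16$. *)
Lemma central_bin_lower_odd r :
  (4 ^ (2 * r.+3).+1 < 'C((2 * r.+3).+1, r.+3) ^ 2 * (2 * (2 * r.+3).+1))%N.
Proof.
elim: r => [|r IH]; first by rewrite !binS !bin0.
rewrite (_ : (2 * r.+4).+1 = (2 * r.+3).+3)%N; last by lia.
rewrite 2!expnS mulnA (_ : 4 * 4 = 16)%N //.
have := @bin_step (2 * r.+3).+1 r.+3; rewrite (_ : (2 * r.+3).+1 - r.+3 = r.+4)%N; last by lia.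
move: IH; move: 'C(_, _) 'C(_, _) (4 ^ _)%N => E' E P IH e.
have {}e : (r.+4.+1 * E' = 2 * (2 * r.+3).+3 * E)%N.
  apply/eqP; rewrite -(@eqn_pmul2l r.+4) // mulnA e; last by lia.
  by apply/eqP; lia.
have e2 : (r.+4.+1 ^ 2 * E' ^ 2 = 4 * (2 * r.+3).+3 ^ 2 * E ^ 2)%N.
  by rewrite -expnMn e !expnMn.
apply: (bound_step (K := r.+4.+1 ^ 2 * (2 * r.+3).+1) (L := 4 * (2 * r.+3).+3 ^ 3) _ _ _ IH).
- by rewrite muln_gt0.
- transitivity (2 * (2 * r.+3).+1 * (2 * r.+3).+3 * (r.+4.+1 ^ 2 * E' ^ 2))%N;
    last by rewrite e2; clear; lia.
  by clear; lia.
- by clear; lia.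
Qed.

(** This is the square of the desired bound. It fails at $m = 5$, where $10^2 \cdot 10 < 4^5$. *)
Lemma central_bin_lower m : (5 < m)%N -> (4 ^ m < 'C(m, m./2) ^ 2 * (2 * m))%N.
Proof.
move=> m5; have := odd_double_half m; set r := m./2.
case: (r) => [|[|[|r']]]; try by case: odd => /= e; lia.
rewrite -muln2 mulnC.
case: (odd m) => /= <-; [exact: central_bin_lower_odd|exact: central_bin_lower_even].
Qed.

Variable R : realType.

Lemma boundE m : 1 / Num.sqrt 2 * (2 ^+ m / Num.sqrt m%:R) =
  2 ^+ m / Num.sqrt (2 * m%:R) :> R.
Proof. by rewrite mul1r mulrCA -invfM sqrtrM. Qed.

Lemma bound_lt_bin m : (5 < m)%N ->
  1 / Num.sqrt 2 * (2 ^+ m / Num.sqrt m%:R) < 'C(m, m./2)%:R :> R.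
Proof.
move=> m5; have m0 : (0 < m)%N by apply: leq_trans m5.
rewrite boundE.
have s0 : 0 < Num.sqrt (2 * m%:R) :> R by rewrite sqrtr_gt0 mulr_gt0 ?ltr0n.
rewrite ltr_pdivrMr // -ltr_sqr ?nnegrE ?exprn_ge0 ?mulr_ge0 ?ler0n ?ltW //.
rewrite exprMn sqr_sqrtr ?mulr_ge0 ?ler0n // -exprM mulnC exprM.
have := central_bin_lower m5; rewrite -(ltr_nat R) natrX natrM natrX natrM => h.
by rewrite -natrX.
Qed.

Lemma bound_Theta k : 
  (fun h : nat => 1 / Num.sqrt 2 * (2 ^+ (1 + h - k)%N / Num.sqrt (1 + h - k)%N%:R) : R)
    =Theta_\oo (fun h : nat => 2 ^+ h / Num.sqrt h%:R : R).
Proof.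
rewrite eqThetaE qualifE; apply/asboolP.
(* The function equals $2 \cdot 2^{-k} 2^h / \sqrt{2m}$ with $m = 1 + h - k$, and $\sqrt h \le
   \sqrt{2m} \le 2 \sqrt h$ once $h \ge 2(k+1)$. *)
exists (2 ^- k, 2 * 2 ^- k); first by rewrite /= mulr_gt0 ?invr_gt0 ?exprn_gt0.
exists (k.+1.*2)%N => // h /= hk.
have kh : (k <= h)%N by lia.
have h0 : 0 < Num.sqrt h%:R :> R by rewrite sqrtr_gt0 ltr0n; lia.
have g0 : 0 <= 2 ^+ h / Num.sqrt h%:R :> R by rewrite divr_ge0 ?exprn_ge0 ?ltW.
set m := (1 + h - k)%N.
have m0 : 0 < Num.sqrt (2 * m%:R) :> R by rewrite sqrtr_gt0 -natrM ltr0n; lia.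
pose c : R := 2 ^- k * 2 ^+ h.
have c0 : 0 < c by rewrite mulr_gt0 ?invr_gt0 ?exprn_gt0.
have l1 : Num.sqrt h%:R <= Num.sqrt (2 * m%:R) :> R.
  by rewrite ler_wsqrtr // -natrM ler_nat; lia.
have l2 : Num.sqrt (2 * m%:R) <= 2 * Num.sqrt h%:R :> R.
  rewrite -ler_sqr ?nnegrE ?(ltW m0) ?mulr_ge0 ?(ltW h0) //.
  rewrite exprMn !sqr_sqrtr ?mulr_ge0 ?ler0n // -natrX -!natrM ler_nat.
  by move: hk; rewrite /m; clear; lia.
have -> : 1 / Num.sqrt 2 * (2 ^+ m / Num.sqrt m%:R) =
          2 * (c / Num.sqrt (2 * m%:R)) :> R.
  rewrite boundE mulrA; congr (_ / _); apply: (@mulIf _ (2 ^+ k)).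
    by rewrite expf_neq0.
  rewrite -exprD /m subnK; last by lia.
  by rewrite /c exprD expr1 -!mulrA; congr (2 * _);
    rewrite mulrC -mulrA mulfV ?expf_neq0 // mulr1.
rewrite (ger0_norm g0) ger0_norm; last by rewrite mulr_ge0 // divr_ge0 // ltW.
have gE : 2 ^- k * (2 ^+ h / Num.sqrt h%:R) = c / Num.sqrt h%:R by rewrite mulrA.
rewrite -(mulrA 2) gE; split.
  rewrite ler_pdivrMr // -mulrA mulrCA -ler_pdivrMl ?divr_gt0 //.
  by rewrite invfM invrK mulrAC mulVf ?gt_eqF // mul1r.
by rewrite ler_pM2l // ler_pM2l // lef_pV2.
Qed.

End Asymptotics.

Theorem theorem6p13 (R : realType) (V : choiceType) (k : nat) :
  let m (h : nat) : nat := (1 + h - k)%N in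
  let bound (h : nat) : R :=
    1 / Num.sqrt 2 * (2 ^+ m h / Num.sqrt (m h)%:R) in
  [/\ forall (h : nat) (T : tree V) (u : {fset literal V} -> V),
        (k + 1 <= h)%N ->
        extremal (k + 1) h T ->
        uniq (labels T) ->
        doping_vars (F1 T) u ->
        ('C(m h, (m h)./2)
           <= matching_number (trigger_hypergraph k (doping u (F1 T))))%N,
      forall h : nat, (k + 5 <= h)%N -> bound h < 'C(m h, (m h)./2)%:R &
      bound =Theta_\oo (fun h : nat => 2 ^+ h / Num.sqrt h%:R : R)].
Proof.
move=> m bound; split; last exact: bound_Theta.
  move=> h T u kh ext uT dv.
  have dop := dopableP uT dv.
  have bT : bushy k (m h) T.
    rewrite /m (_ : (1 + h - k = (h - k).+1)%N); last by lia.
    by apply: (extremal_bushy ext); move: kh; clear; lia.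
  (* Since $h \ge k + 1$ gives $m \ge 2$, the chosen half-size sets are nonempty. *)
  have m2 : (0 < (m h)./2)%N by rewrite half_gt0 /m; lia.
  have := matching_number_well_separated dop (well_separated_spread m2 bT).
  rewrite card_sig -[#|_|]/(#|[pred A : {set 'I_(m h)} | #|A| == (m h)./2]|).
  by rewrite -(cardsE [pred A : {set 'I_(m h)} | _]) card_draws card_ord.
by move=> h hk; apply: bound_lt_bin; rewrite /m; lia.
Qed.
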